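(* Every Suleĭmanova spectrum is realizable. That is, if $\sigma = \{\lambda_1, \dots, \lambda_n\} \subset \mathbb{R}$ (a finite list, repetitions allowed) contains exactly one positive element and satisfies $\sum_{i=1}^n \lambda_i \ge 0$, then there exists an $n \times n$ entrywise nonnegative matrix whose spectrum (eigenvalues counted with algebraic multiplicity) is $\sigma$.
   Context: A set $\sigma = \{\lambda_1,\dots,\lambda_n\} \subset \mathbb{R}$ is understood as a list (multiset) of $n$ real numbers, counted with multiplicity. It is called a Suleĭmanova spectrum if $s_1(\sigma) := \sum_{i=1}^n \lambda_i \ge 0$ and $\sigma$ contains exactly one positive element. It is called realizable if it is the spectrum, counted with algebraic multiplicity, of some $n \times n$ matrix all of whose entries are nonnegative real numbers; such a matrix is called a realizing matrix for $\sigma$, and is said to realize $\sigma$. *)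

(* Defs.v *)
From mathcomp Require Import all_boot all_order all_algebra.
From mathcomp Require Import complex reals.

Set Implicit Arguments.
Unset Strict Implicit.
Unset Printing Implicit Defensive.

Import Order.TTheory GRing.Theory Num.Theory.
Local Open Scope ring_scope.

(* The spectrum of a real matrix lives in the complex numbers, so eigenvalues
   and their algebraic multiplicities are taken over R[i]. *)
Definition alg_mult (R : realType) (n : nat) (A : 'M[R]_n) (z : R[i]) : nat :=
  mup z (char_poly (map_mx (real_complex R) A)).

(* Equality of multisets: every complex z occurs in the list sigma as often as
   it occurs as an eigenvalue of A. *)
Definition has_spectrum (R : realType) (n : nat) (A : 'M[R]_n)
    (sigma : n.-tuple R) : Prop :=
  forall z : R[i], alg_mult A z = count_mem z (map (real_complex R) sigma).

Definition nonneg_mx (R : realType) (n : nat) (A : 'M[R]_n) : Prop :=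
  forall i j, 0 <= A i j.

Definition realizes (R : realType) (n : nat) (A : 'M[R]_n)
    (sigma : n.-tuple R) : Prop :=
  nonneg_mx A /\ has_spectrum A sigma.

Definition realizable (R : realType) (n : nat) (sigma : n.-tuple R) : Prop :=
  exists A : 'M[R]_n, realizes A sigma.

Definition s1 (R : realType) (n : nat) (sigma : n.-tuple R) : R :=
  \sum_(i < n) tnth sigma i.

(* The positive element is unique counted with multiplicity, i.e. exactly one
   index carries a positive entry. *)
Definition suleimanova (R : realType) (n : nat) (sigma : n.-tuple R) : Prop :=
  0 <= s1 sigma /\ count (fun x : R => 0 < x) sigma = 1%N.

(* Main.v *)
(* With s the sum of l_0 > 0 >= l_1, ..., l_n, take the matrix A whose first row
   is (s, s - l_1, ..., s - l_n) and whose i-th row is -l_i off the diagonal and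
   0 on it.  It is nonnegative and all its columns sum to l_0, so the row vectors
   1, e_1, ..., e_n satisfy 1 A = l_0 1 and e_i A = l_i e_i - l_i 1: in this
   basis A is triangular with diagonal l_0, ..., l_n. *)
Require Import Defs.
From mathcomp Require Import all_boot all_order all_algebra.
From mathcomp Require Import complex reals ring.

Set Implicit Arguments.
Unset Strict Implicit.
Unset Printing Implicit Defensive.

Import Order.TTheory GRing.Theory Num.Theory.
Local Open Scope ring_scope.

(** The relation lifts to [P (X - A) = (X - B) P] over polynomials; taking determinants and using
    [\det P = 1] gives the claim without inverting [P]. *)
Lemma char_poly_intertwine (R : comNzRingType) (n : nat) (P A B : 'M[R]_n) :
  \det P = 1 -> P *m A = B *m P -> char_poly A = char_poly B.
Proof.
move=> detP PA.
have PAX : map_mx polyC P *m char_poly_mx A = char_poly_mx B *m map_mx polyC P.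
  by rewrite mulmxBr mulmxBl -scalar_mxC -!map_mxM /= PA.
have := congr1 determinant PAX.
by rewrite !det_mulmx det_map_mx detP rmorph1 mul1r mulr1.
Qed.

Definition suleimanova_mx (R : nzRingType) (n : nat) (l : 'I_n.+1 -> R) :
    'M[R]_n.+1 :=
  \matrix_(i, j)
    if i == 0 then \sum_k l k - (if j == 0 then 0 else l j)
    else if i == j then 0 else - l i.

Lemma char_poly_suleimanova_mx (R : comNzRingType) (n : nat)
    (l : 'I_n.+1 -> R) :
  char_poly (suleimanova_mx l) = \prod_i ('X - (l i)%:P).
Proof.
(* The rows of [P] are the basis vectors 1, e_1, ..., e_n, and row [i] of [T] gives the image of the
   [i]-th one in this basis. *)
pose P : 'M[R]_n.+1 := \matrix_(i, j) ((i == 0) || (i == j))%:R.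
pose T : 'M[R]_n.+1 :=
  \matrix_(i, j) ((i == j)%:R * l i - ((i != 0) && (j == 0))%:R * l i).
have detP : \det P = 1.
  (* [P] is upper triangular, while [is_trig_mx] means lower triangular. *)
  rewrite -det_tr det_trig; last first.
    apply/is_trig_mxP => i j ltij; rewrite !mxE.
    have [j0|_] := eqVneq j 0; first by rewrite j0 in ltij.
    by have [ji|//] := eqVneq j i; rewrite ji ltnn in ltij.
  by rewrite big1 // => i _; rewrite !mxE eqxx orbT.
have trigT : is_trig_mx T.
  apply/is_trig_mxP => i j ltij; rewrite !mxE.
  have [ij|_] := eqVneq i j; first by rewrite ij ltnn in ltij.
  have [j0|_] := eqVneq j 0; first by rewrite j0 in ltij.
  by rewrite andbF !mul0r subr0.
rewrite (char_poly_intertwine (B := T) detP) ?char_poly_trig //.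
  apply: eq_bigr => i _; rewrite mxE eqxx mul1r.
  by case: eqVneq => [->|_]; rewrite ?eqxx ?mul0r ?subr0 //=.
apply/matrixP => i j; rewrite !mxE.
(* Row 0 of the identity says that every column sums to [l 0]. *)
have [-> | i0] := eqVneq i 0.
  rewrite [RHS](bigD1 0) //= [X in _ = _ + X]big1 => [|k k0]; last first.
    by rewrite !mxE eqxx /= eq_sym (negPf k0) !mul0r subrr mul0r.
  rewrite !mxE eqxx mul0r subr0 addr0 mul1r mulr1.
  rewrite big_ord_recl !mxE eqxx mul1r.
  under [X in _ + X = _]eq_bigr => k _ do rewrite !mxE eqxx mul1r /=.
  rewrite big_ord_recl.
  (* For [j != 0] the zero on the diagonal leaves out [- l j], which the top entry supplies. *)
  case: (unliftP ord0 j) => [k|] ->.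
    rewrite /= [X in _ + X = _](bigD1 k) //= eqxx add0r.
    under [X in _ + X = _]eq_bigr => i' ik
      do rewrite (inj_eq lift_inj) (negPf ik).
    by rewrite sumrN (bigD1 k) //=; ring.
  rewrite eqxx subr0 /= -addrA -big_split big1 ?addr0 //= => k _.
  by rewrite subrr.
(* Row [i] of [P] is e_i, so the left side is a matrix entry; on the right only columns [i] and 0 of
   [T] contribute. *)
rewrite (bigD1 i) //= big1 ?addr0 => [|k ki]; last first.
  by rewrite !mxE (negPf i0) eq_sym (negPf ki) mul0r.
rewrite !mxE eqxx orbT (negPf i0) mul1r.
rewrite (bigD1 i) //= (bigD1 0) 1?eq_sym //= big1 => [|k /andP[ki k0]]; last first.
  by rewrite !mxE (negPf i0) (negPf k0) eq_sym (negPf ki) !mul0r subrr mul0r.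
rewrite !mxE !eqxx (negPf i0) /= [j == i]eq_sym.
by case: (i == j) => /=; ring.
Qed.

Lemma suleimanova_mx_ge0 (R : numDomainType) (n : nat) (l : 'I_n.+1 -> R) :
  0 <= \sum_k l k -> (forall i, i != 0 -> l i <= 0) ->
  forall i j, 0 <= suleimanova_mx l i j.
Proof.
move=> sl_ge0 l_le0 i j; rewrite mxE.
have [_|i0] := eqVneq i 0.
  have [_|j0] := eqVneq j 0; first by rewrite subr0.
  by rewrite subr_ge0 (le_trans (l_le0 _ j0)).
by case: ifP => // _; rewrite oppr_ge0 l_le0.
Qed.

(** A factorization into linear factors over [R] persists over [R[i]], where the multiplicity of a
    root counts its factors. *)
Lemma char_poly_has_spectrum (R : realType) (n : nat) (A : 'M[R]_n)
    (sigma : n.-tuple R) :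
  char_poly A = \prod_(x <- sigma) ('X - x%:P) -> has_spectrum A sigma.
Proof.
move=> charA z; rewrite /alg_mult -map_char_poly charA rmorph_prod.
under eq_bigr => x _ do rewrite rmorphB /= map_polyX map_polyC.
by rewrite -(big_map (real_complex R) xpredT (fun y => 'X - y%:P)) mu_prod_XsubC.
Qed.

Theorem theorem3p3 (R : realType) (n : nat) (sigma : n.-tuple R) :
  suleimanova sigma -> realizable sigma.
Proof.
case=> s1_ge0 count1.
have [p p_sigma p_gt0] : exists2 p, p \in sigma & 0 < p.
  by apply/hasP; rewrite has_count count1.
have perm_sigma := perm_to_rem p_sigma.
case: n sigma s1_ge0 count1 p_sigma perm_sigma
  => [|n] sigma s1_ge0 count1 p_sigma perm_sigma.
  by rewrite tuple0 in p_sigma.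
have size_tau : size (p :: rem p sigma) == n.+1.
  by rewrite -(perm_size perm_sigma) size_tuple.
(* A reordering of [sigma] that puts the positive element at index 0; the sum and the spectrum
   ignore order. *)
pose tau := Tuple size_tau.
have rem_le0 x : x \in rem p sigma -> x <= 0.
  (* Since [p] accounts for the whole count, no positive element remains. *)
  have := count1; rewrite (seq.permP perm_sigma) /= p_gt0 => -[/eqP].
  rewrite -leqn0 leqNgt -has_count => /hasPn rem_gt0 /rem_gt0.
  by rewrite -real_leNgt ?num_real.
exists (suleimanova_mx (tnth tau)); split.
  apply: suleimanova_mx_ge0 => [|i i0].
    by move: s1_ge0; rewrite /s1 -!(big_tuple _ _ _ xpredT id) (perm_big _ perm_sigma).
  apply: rem_le0; case: (unliftP ord0 i) i0 => [k ->|->] // _.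
  by rewrite (tnth_nth 0) /= mem_nth // size_rem // size_tuple ltn_ord.
apply: char_poly_has_spectrum; rewrite char_poly_suleimanova_mx.
by rewrite (perm_big _ perm_sigma) -[LHS](big_tuple _ _ tau xpredT (fun x => 'X - x%:P)).
Qed.
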